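(* For every integer $k\geq 1$, the formula with reversal $\phi_k$ is $3$-unavoidable; that is, only finitely many words over a $3$-letter alphabet avoid $\phi_k$.
   Context: Let $\Sigma$ be a set of variables and $\Sigma^R=\{x^R:x\in\Sigma\}$. For words, $(a_1\cdots a_n)^R=a_n\cdots a_1$. A morphism $h$ on $(\Sigma\cup\Sigma^R)^*$ respects reversal if $h(x^R)=h(x)^R$. For $k\geq1$, $\phi_k$ is the formula with reversal whose fragments are $xy_1y_2\cdots y_kx$, $y_1^R,\dots,y_k^R$. A formula occurs in a word $u$ if there is a non-erasing morphism $h$ respecting reversal such that the image of every fragment is a factor of $u$; otherwise $u$ avoids it. A formula is $3$-unavoidable if it is not the case that infinitely many words over a $3$-letter alphabet avoid it. *)

(* Defs.v *)
From mathcomp Require Import all_boot.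
From mathcomp Require Import classical_sets cardinality.

Set Implicit Arguments.
Unset Strict Implicit.
Unset Printing Implicit Defensive.

(* [inl x] is the variable x and [inr x] is the formal letter x^R. *)
Definition rletter (V : eqType) : eqType := (V + V)%type.

Definition rvar (V : eqType) (x : V) : rletter V := inl x.
Definition rrev (V : eqType) (x : V) : rletter V := inr x.

(* A formula with reversal, given as the sequence of its fragments. *)
Definition rformula (V : eqType) := seq (seq (rletter V)).

Definition word_morphism (B A : Type) (h : seq B -> seq A) : Prop :=
  h [::] = [::] /\ forall u v, h (u ++ v) = h u ++ h v.

Definition non_erasing (B A : Type) (h : seq B -> seq A) : Prop :=
  forall b, h [:: b] <> [::].

Definition respects_reversal (V : eqType) (A : Type)
    (h : seq (rletter V) -> seq A) : Prop :=
  forall x : V, h [:: rrev x] = rev (h [:: rvar x]).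

Definition occurs (V A : eqType) (f : rformula V) (u : seq A) : Prop :=
  exists h : seq (rletter V) -> seq A,
    [/\ word_morphism h, non_erasing h, respects_reversal h
      & forall p, p \in f -> infix (h p) u].

Definition avoids (V A : eqType) (u : seq A) (f : rformula V) : Prop :=
  ~ occurs f u.

Definition avoidable (n : nat) (V : eqType) (f : rformula V) : Prop :=
  infinite_set [set u : seq 'I_n | avoids u f]%classic.

Definition unavoidable (n : nat) (V : eqType) (f : rformula V) : Prop :=
  ~ avoidable n f.

(* In phi k the variable x is [None] and y_(i+1) is [Some i], for i < k. *)
Definition phi_x (k : nat) : option 'I_k := None.
Definition phi_y (k : nat) (i : 'I_k) : option 'I_k := Some i.

Definition phi (k : nat) : rformula (option 'I_k) :=
  (rvar (phi_x k) :: [seq rvar (phi_y i) | i <- enum 'I_k]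
     ++ [:: rvar (phi_x k)])
  :: [seq [:: rrev (phi_y i)] | i <- enum 'I_k].

(* Main.v *)
(** Call a factor of [u] reversible if its reversal is also a factor of [u].
    Factors of reversible words are reversible, so [phi k] occurs in [u] as soon
    as [u] has a factor [x w x] with [x] nonempty and [k <= |w|] such that [w] is
    a product of at most [k] reversible words.

    For [k <= 4] an exhaustive search shows that every ternary word of length 16
    has such a factor.  For [k >= 5], suppose that a long word [u] has none.  If
    [u] reads [ab] with [a <> b] at position [i], the [k + 1] letters after [a]
    cannot be a product of [k - 1] reversible words: otherwise neither [a] nor
    [b] could follow them, so the third letter would, and repeatedly so, since a
    run is a single reversible word.  Hence reversible factors of length 2 are
    sparse, and somewhere there are three consecutive irreversible ones.  These
    must form a cycle [abca], so that [u] runs through the cycle [abc], pausing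
    on doubled letters that are at least [k] apart.  A stretch of length [k + 6]
    without doubled letter contains a suitable [x w x] because it has period 3;
    otherwise a [w] of length [k] or [k + 1] around an isolated doubled letter
    does it. *)
Require Import Defs.
From mathcomp Require Import all_boot.
From mathcomp Require Import zify.
From mathcomp Require cardinality.

Set Implicit Arguments.
Unset Strict Implicit.
Unset Printing Implicit Defensive.

(** * Products of at most [c] reversible words *)

Section Splits.
Variables (A : eqType) (u : seq A).

(** Pieces may be empty or fewer than [c], so the notion is monotone in [c]; [splits_exact] recovers
    exactly [c] nonempty ones. *)
Definition splits (c : nat) (w : seq A) : Prop :=
  exists ys, [/\ size ys <= c, flatten ys = w & all (fun y => infix (rev y) u) ys].

Lemma splits0 : splits 0 [::].
Proof. by exists [::]. Qed.

Lemma splits1 w : infix (rev w) u -> splits 1 w.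
Proof. by move=> hw; exists [:: w]; rewrite /= cats0 hw. Qed.

Lemma splits_cat c1 c2 w1 w2 :
  splits c1 w1 -> splits c2 w2 -> splits (c1 + c2) (w1 ++ w2).
Proof.
move=> [ys [s1 <- a1]] [zs [s2 <- a2]]; exists (ys ++ zs).
by rewrite size_cat leq_add // flatten_cat all_cat a1 a2.
Qed.

Lemma splits_leq c1 c2 w : c1 <= c2 -> splits c1 w -> splits c2 w.
Proof. by move=> le12 [ys [s1 h a1]]; exists ys; split=> //; apply: leq_trans le12. Qed.

Lemma infix_rev_take n y : infix (rev y) u -> infix (rev (take n y)) u.
Proof. by rewrite -{1}(cat_take_drop n y) rev_cat; apply: catl_infix. Qed.

Lemma infix_rev_drop n y : infix (rev y) u -> infix (rev (drop n y)) u.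
Proof. by rewrite -{1}(cat_take_drop n y) rev_cat; apply: catr_infix. Qed.

Lemma splits_behead c w : splits c w -> splits c (behead w).
Proof.
move=> [ys [hs <- {w} ha]].
elim: ys c hs ha => [|y ys IH] [|c] //= hs; first by exists [::].
  by exists [::].
case/andP=> hy ha; case: y hy => [|a y] hy /=.
  by apply: splits_leq (leqnSn c) _; apply: IH.
exists (y :: ys); split=> //=.
by rewrite ha andbT; have := infix_rev_drop 1 hy; rewrite /= drop0.
Qed.

Lemma splits_letters w : {subset w <= u} -> splits (size w) w.
Proof.
elim: w => [|a w IH] hw; first exact: splits0.
rewrite -cat1s -[size _]/(1 + size w); apply: splits_cat.
  apply: splits1; have: a \in u by apply: hw; rewrite mem_head.
  by case/path.splitPr=> p1 p2; apply: (infix_infix p1 [:: a]).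
by apply: IH => b hb; apply: hw; rewrite in_cons hb orbT.
Qed.

Lemma split_piece c y : 0 < c <= size y -> infix (rev y) u ->
  exists zs, [/\ size zs = c, flatten zs = y, all (fun y => infix (rev y) u) zs
     & [::] \notin zs].
Proof.
elim: c y => [|[|c] IH] y //=.
  case: y => [|a y] // _ hy; exists [:: a :: y].
  by rewrite /= cats0 hy.
case: y => [|a y] // hc hy.
have [||zs [h1 h2 h3 h4]] := IH y; first by rewrite /= in hc *; lia.
  by have := infix_rev_drop 1 hy; rewrite /= drop0.
exists ([:: a] :: zs); rewrite /= h1 h2 h3 in_cons /= h4; split=> //.
by have := infix_rev_take 1 hy; rewrite /= take0 => ->.
Qed.

(** A non-erasing morphism needs exactly [c] nonempty pieces: empty ones are dropped, then single
    letters are cut off long ones. *)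
Lemma splits_exact c w : splits c w -> c <= size w ->
  exists zs, [/\ size zs = c, flatten zs = w, all (fun y => infix (rev y) u) zs
     & [::] \notin zs].
Proof.
move=> [ys [hs <- {w} ha]].
have [xs [hxs <- {}ha hn]] : exists xs, [/\ size xs <= c, flatten xs = flatten ys,
    all (fun y => infix (rev y) u) xs & [::] \notin xs].
  elim: ys c hs ha => [|y ys IH] [|c] //= hs; try by exists [::].
  case/andP=> hy ha; have [xs [h1 h2 h3 h4]] := IH c hs ha.
  case: y hy => [|a y] hy; first by exists xs; split=> //; apply: leqW.
  by exists ((a :: y) :: xs); rewrite /= h2 h3 hy in_cons.
elim: xs c hxs ha hn {ys hs} => [|y ys IH] c hs.
  by rewrite leqn0 => _ _ /eqP->; exists [::].
case/andP=> hy ha; rewrite in_cons negb_or => /andP[hy0 hn] hc.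
have hys : size ys <= size (flatten ys).
  elim: ys hn {IH hs ha hc} => //= z ys IH; rewrite in_cons negb_or.
  by case/andP=> hz /IH {}IH; rewrite size_cat; case: z hz => //= a z _; lia.
have hy1 : 0 < size y by case: y hy0 {hs hy hc}.
rewrite /= size_cat in hs hc.
(* The first piece supplies what the others, even cut into letters, cannot. *)
have [||zy [s1 f1 a1 n1]] := @split_piece (maxn 1 (c - size (flatten ys))) y => //.
  by lia.
have [||zs [s2 f2 a2 n2]] := IH (c - maxn 1 (c - size (flatten ys))) _ ha hn; try lia.
exists (zy ++ zs); rewrite size_cat flatten_cat all_cat mem_cat s1 s2 f1 f2 a1 a2.
by rewrite (negbTE n1) (negbTE n2); split=> //; lia.
Qed.

Lemma occurs_phi (k : nat) (p x w q : seq A) :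
  u = p ++ x ++ w ++ x ++ q -> x != [::] -> k <= size w -> splits k w ->
  occurs (phi k) u.
Proof.
move=> hu hx hk /splits_exact /(_ hk) [ys [hs hf ha hn]].
pose h1 (l : rletter (option 'I_k)) := match l with
  | inl None => x | inl (Some i) => nth [::] ys i
  | inr None => rev x | inr (Some i) => rev (nth [::] ys i) end.
have hnth (i : 'I_k) : nth [::] ys i \in ys by rewrite mem_nth // hs.
have hy0 (i : 'I_k) : nth [::] ys i != [::].
  by apply: contra hn => /eqP <-.
have revN (v : seq A) : v != [::] -> rev v <> [::].
  by move=> hv /(congr1 rev); rewrite revK => /eqP; rewrite (negbTE hv).
exists (fun s => flatten (map h1 s)); split.
- by split=> // s t; rewrite map_cat flatten_cat.
- case=> [[i|]|[i|]] /=; rewrite cats0; first exact/eqP; first exact/eqP.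
    exact: revN.
  exact: revN.
- by case=> [i|] /=; rewrite !cats0.
move=> f; rewrite in_cons => /orP[/eqP->|/mapP[i _ ->]]; last first.
  by rewrite /= cats0; apply: (allP ha).
rewrite /= map_cat flatten_cat -map_comp /= cats0.
suff -> : flatten [seq (h1 \o (fun i => rvar (phi_y i))) i | i <- enum 'I_k] = w.
  by apply/infixP; exists p, q; rewrite hu -!catA.
rewrite -hf; congr flatten.
rewrite -[RHS](mkseq_nth [::]) hs /mkseq -val_enum_ord -map_comp.
by apply: eq_map.
Qed.
End Splits.

Lemma occurs_infix (V A : eqType) (f : rformula V) (u v : seq A) :
  infix u v -> occurs f u -> occurs f v.
Proof.
move=> uv [h [h1 h2 h3 h4]]; exists h; split=> // p /h4 hp.
exact: infix_trans uv.
Qed.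

(** Letterwise maps commute with reversal; this brings the search over [nat] back to ['I_3]. *)
Lemma occurs_map (V A B : eqType) (g : A -> B) (f : rformula V) (u : seq A) :
  occurs f u -> occurs f (map g u).
Proof.
move=> [h [[h0 hM] h2 h3 h4]]; exists (map g \o h); split=> /=.
- by split=> [|s t]; rewrite /= ?h0 // hM map_cat.
- by move=> b /=; have := h2 b; case: (h _).
- by move=> x /=; rewrite h3 map_rev.
- move=> p /h4 /infixP[s [t ->]]; apply/infixP.
  by exists (map g s), (map g t); rewrite !map_cat.
Qed.

(** * Small k *)

(* Greedy: [n] is the length of the longest reversible prefix of [w]. *)
Fixpoint splitsb (u : seq nat) (c : nat) (w : seq nat) : bool :=
  if w is [::] then true else
  if c is c'.+1 then
    let n := find (fun n => ~~ infix (rev (take n w)) u) (iota 1 (size w)) in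
    if infix (rev (take n w)) u then splitsb u c' (drop n w) else false
  else false.

Lemma splitsbP u c w : splitsb u c w -> splits u c w.
Proof.
elim: c w => [|c IH] [|a w] //; try by exists [::].
rewrite /splitsb -/splitsb; set n := find _ _.
case: ifP => // h1 /IH h2; rewrite -(cat_take_drop n (a :: w)) -add1n.
by apply: splits_cat => //; apply: splits1.
Qed.

(* [|x| <= 4] suffices for the searches below. *)
Definition occursb (k : nat) (u : seq nat) : bool :=
  has (fun i => has (fun l => has (fun n =>
    let v := drop i u in
    let x := take l v in
    let w := take n (drop l v) in
    let r := drop n (drop l v) in
    if ~~ prefix x r then false else
    if x is [::] then false else
    if k <= size w then splitsb u k w else false)
  (iota k (size u))) (iota 1 4)) (iota 0 (size u)).

Lemma occursbP k u : occursb k u -> occurs (phi k) u.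
Proof.
case/hasP=> i _ /hasP[l _] /hasP[n _] /=.
case: ifP => // /negbFE /prefixP[q hq].
case hx: (take l _) => [|a x] //; case: ifP => // hk /splitsbP hs.
apply: (@occurs_phi _ u k (take i u) (a :: x) _ q _ _ hk hs) => //.
by rewrite -hx -hq cat_take_drop cat_take_drop cat_take_drop.
Qed.

(** A branch closes at the first occurrence, since [u] stays a suffix of every extension. *)
Fixpoint all_extensions_occur (k f : nat) (u : seq nat) : bool :=
  if occursb k u then true else
  if f is f'.+1 then
    all (fun c => all_extensions_occur k f' (c :: u)) [:: 0; 1; 2]
  else false.

Lemma all_extensions_occurP k f u z :
  all_extensions_occur k f u -> size z = f -> all (fun c => c < 3) z ->
  occurs (phi k) (z ++ u).
Proof.
elim: f u z => [|f IH] u z; rewrite /all_extensions_occur -/all_extensions_occur.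
  by case: ifP => // /occursbP hu _ _ _; apply: occurs_infix (suffix_infix _ _) hu.
case: ifP => [/occursbP hu _ _ _|_]; first by apply: occurs_infix (suffix_infix _ _) hu.
case/lastP: z => // z c hall; rewrite size_rcons => -[hz].
rewrite all_rcons => /andP[hc hz3]; rewrite cat_rcons; apply: IH => //.
by apply: (allP hall); move: hc; case: c => [|[|[]]].
Qed.

Lemma all_extensions_occur_small k :
  1 <= k <= 4 -> all_extensions_occur k 16 [::].
Proof. by case: k => [|[|[|[|[|k]]]]] // _; reflexivity. Qed.

Lemma occurs_small k (u : seq 'I_3) :
  1 <= k <= 4 -> 16 <= size u -> occurs (phi k) u.
Proof.
move=> hk hu.
have hv : all (fun c => c < 3) (map val (take 16 u)).
  by rewrite all_map; apply/allP => i _; apply: ltn_ord.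
have := all_extensions_occurP (all_extensions_occur_small hk) _ hv.
rewrite size_map size_takel // cats0 => /(_ (erefl _)).
move=> /(occurs_map (fun m => inord m : 'I_3)).
rewrite -map_comp map_id_in => [|i _ /=]; last by rewrite inord_val.
exact/occurs_infix/infix_take.
Qed.

(** * Large k *)

Lemma ord3_third (a b x y : 'I_3) :
  a != b -> x != a -> x != b -> y != a -> y != b -> x = y.
Proof.
rewrite -!val_eqE /= => h1 h2 h3 h4 h5; apply: val_inj => /=.
by move: (ltn_ord a) (ltn_ord b) (ltn_ord x) (ltn_ord y); lia.
Qed.

Section Large.
Variables (k : nat) (u : seq 'I_3).
Hypothesis avoid_u : ~ occurs (phi k) u.

Local Notation N := (size u).
Local Notation s := (nth ord0 u).
Local Notation fac i n := (take n (drop i u)).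
Local Notation splits := (splits u).

Lemma facD i m n : fac i (m + n) = fac i m ++ fac (i + m) n.
Proof. by rewrite takeD drop_drop addnC. Qed.

Lemma size_fac i n : i + n <= N -> size (fac i n) = n.
Proof. by move=> h; rewrite size_takel // size_drop; lia. Qed.

Lemma nth_fac i n t : t < n -> nth ord0 (fac i n) t = s (i + t).
Proof. by move=> h; rewrite nth_take // nth_drop. Qed.

Lemma splits_fac i n : i + n <= N -> splits n (fac i n).
Proof.
move=> h; rewrite -{1}(size_fac h); apply: splits_letters => a /mem_take.
exact: mem_drop.
Qed.

Lemma splits_facD i c1 c2 m n :
  splits c1 (fac i m) -> splits c2 (fac (i + m) n) ->
  splits (c1 + c2) (fac i (m + n)).
Proof. by move=> h1 h2; rewrite facD; apply: splits_cat. Qed.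

Lemma splits_fac_behead i c n :
  i < N -> splits c (fac i n.+1) -> splits c (fac i.+1 n).
Proof.
by move=> h /splits_behead; rewrite (drop_nth ord0 h) /=.
Qed.

Lemma splits_const i n c :
  i + n <= N -> (forall t, t < n -> s (i + t) = c) -> splits 1 (fac i n).
Proof.
move=> h hc; have e : fac i n = nseq n c.
  apply: (@eq_from_nth _ ord0) => [|t]; rewrite size_fac // ?size_nseq // => ht.
  by rewrite nth_fac // hc // nth_nseq ht.
apply: splits1; rewrite e rev_nseq -e.
apply/infixP; exists (take i u), (drop n (drop i u)).
by rewrite cat_take_drop cat_take_drop.
Qed.

Lemma avoid_xwx i l n : 0 < l -> k <= n -> i + l + n + l <= N ->
  splits k (fac (i + l) n) ->
  ~ (forall t, t < l -> s (i + t) = s (i + l + n + t)).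
Proof.
move=> l0 kn hN hs heq; apply: avoid_u.
have e : fac i l = fac (i + l + n) l.
  apply: (@eq_from_nth _ ord0) => [|t]; rewrite !size_fac //; try lia.
  by move=> ht; rewrite !nth_fac // heq.
apply: (@occurs_phi _ u k (take i u) (fac i l) (fac (i + l) n)
  (drop (i + l + n + l) u)) => //.
- rewrite {2}e -{1}(cat_take_drop i u) -{1}(cat_take_drop l (drop i u)).
  rewrite drop_drop [l + i]addnC -{1}(cat_take_drop n (drop (i + l) u)).
  rewrite drop_drop [n + _]addnC -{1}(cat_take_drop l (drop (i + l + n) u)).
  by rewrite drop_drop [l + (_ + _)]addnC.
- by rewrite -size_eq0 size_fac //; lia.
- by rewrite size_fac //; lia.
Qed.

Lemma avoid_letter i n : k <= n -> i + n.+1 < N ->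
  splits k (fac i.+1 n) -> s (i + n.+1) != s i.
Proof.
move=> kn hN hs; apply/eqP => heq.
apply: (@avoid_xwx i 1 n) => //; try lia; first by rewrite addn1.
by case=> // _; rewrite !addn0 addn1 addSnnS.
Qed.

Lemma avoid_next i : i + k.+1 < N -> s (i + k.+1) != s i.
Proof. by move=> h; apply: avoid_letter => //; apply: splits_fac; lia. Qed.

(* If the window is cheaper than [k], then neither [s i] nor [s i.+1] can occur
   right after it, so the third letter does, and is then repeated for ever:
   a run only costs one piece. *)
Lemma cheap_window i : 0 < k -> i + 2 * k + 4 <= N -> s i != s i.+1 ->
  ~ splits k.-1 (fac i.+1 k.+1).
Proof.
move=> k0 hN hi hs; set c := s (i + k.+2).
(* A run of [k.+2] letters has equal letters at distance [k.+1], against [avoid_next]. *)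
have run t : t <= k.+1 -> forall t', t' <= t -> s (i + k.+2 + t') = c.
  elim: t => [|t IH] ht t'; first by case: t' => // _; rewrite addn0.
  rewrite leq_eqVlt => /orP[/eqP->|]; last by apply: IH; lia.
  have sp m : 0 < m <= t.+1 -> splits k (fac i.+1 (k.+1 + m)).
    move=> hm; apply: (@splits_leq _ _ (k.-1 + 1)); first lia.
    apply: splits_facD => //.
    apply: (@splits_const _ _ c); first lia.
    move=> t2 ht2; rewrite -(IH _ t2); try lia.
    by congr (s _); lia.
  (* Dropping the first letter of the window excludes [s i.+1]; [k < n] leaves at least [k]
     letters. *)
  have ne n : k < n <= k.+1 + t.+1 -> splits k (fac i.+1 n) ->
      (s (i + n.+1) != s i) * (s (i + n.+1) != s i.+1).
    move=> hn hsp; split; first by apply: avoid_letter => //; lia.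
    case: n hn hsp => // n hn hsp; rewrite -addSnnS.
    by apply: avoid_letter; try lia; apply: splits_fac_behead => //; lia.
  have [] := ne k.+1; first lia.
    by apply: splits_leq hs; lia.
  have [] := ne (k.+1 + t.+1); [lia|by apply: sp; lia|].
  move=> h1 h2 h3 h4; apply: (ord3_third hi) => //.
  - by rewrite (_ : i + _ + _ = i + (k.+1 + t.+1).+1) //; lia.
  - by rewrite (_ : i + _ + _ = i + (k.+1 + t.+1).+1) //; lia.
have /eqP[] : s (i + k.+2 + k.+1) != s (i + k.+2) by apply: avoid_next; lia.
by rewrite (run k.+1).
Qed.

(** * Reversible factors of length 2 *)

Definition rev_edge e := infix [:: s e.+1; s e] u.

Lemma fac2 e : e.+1 < N -> fac e 2 = [:: s e; s e.+1].
Proof.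
move=> h; apply: (@eq_from_nth _ ord0); first by rewrite size_fac //; lia.
move=> t; rewrite size_fac; last lia.
by case: t => [|[]] // _; rewrite nth_fac // ?addn0 ?addn1.
Qed.

Lemma splits_rev_edge e : e.+1 < N -> rev_edge e -> splits 1 (fac e 2).
Proof. by move=> h he; apply: splits1; rewrite fac2. Qed.

Lemma infix_edge e : e.+1 < N -> infix [:: s e; s e.+1] u.
Proof.
move=> h; rewrite -fac2 //; apply/infixP; exists (take e u), (drop 2 (drop e u)).
by rewrite !cat_take_drop.
Qed.

Lemma loop_rev_edge e : e.+1 < N -> s e = s e.+1 -> rev_edge e.
Proof. by move=> /infix_edge; rewrite /rev_edge => + h; rewrite h. Qed.

Hypothesis k5 : 5 <= k.

(** A different letter before the cube would start a cheap window: one piece for the cube and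
    [k - 2] letters. *)
Lemma cube_prefix e : e + 2 * k + 4 <= N ->
  s e = s e.+1 -> s e = s e.+2 -> forall t, t <= e -> s t = s e.
Proof.
elim: e => [|e IH] hN e1 e2 t ht; first by case: t ht.
have [h|hne] := eqVneq (s e) (s e.+1).
  move: ht; rewrite leq_eqVlt => /orP[/eqP->|] //; rewrite -h.
  by apply: IH; rewrite ?h -?e1 //; lia.
exfalso; apply: (@cheap_window e) => //; try lia.
rewrite (_ : k.-1 = 1 + (k - 2)); last lia.
rewrite (_ : k.+1 = 3 + (k - 2)); last lia.
apply: splits_facD; last by apply: splits_fac; lia.
apply: (@splits_const _ _ (s e.+1)); first lia.
by case=> [|[|[]]] // _; rewrite ?addn0 ?addn1 ?addn2.
Qed.

Lemma no_cube e : k < e -> e + 2 * k + 4 <= N -> s e = s e.+1 -> s e.+1 != s e.+2.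
Proof.
move=> ke hN e1; apply/eqP => e2.
have /eqP[] : s (0 + k.+1) != s 0 by apply: avoid_next; lia.
have h := cube_prefix hN e1 (etrans e1 e2).
by rewrite h // h //; lia.
Qed.

(** Two disjoint reversible pairs in a window of [k.+1] letters save two pieces. *)
Lemma rev_edge_gap_start e f : e + 2 * k + 4 <= N -> s e != s e.+1 ->
  rev_edge e.+1 -> rev_edge f -> e.+2 < f -> e.+1 + k <= f.
Proof.
move=> hN he r1 r2 hf; rewrite leqNgt; apply/negP => hfk.
apply: (@cheap_window e) => //; first lia.
rewrite (_ : k.-1 = 1 + ((f - e.+3) + (1 + (e.+1 + k - f.+1)))); last lia.
rewrite (_ : k.+1 = 2 + ((f - e.+3) + (2 + (e.+1 + k - f.+1)))); last lia.
apply: splits_facD; first by apply: splits_rev_edge => //; lia.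
apply: splits_facD; first by apply: splits_fac; lia.
rewrite (_ : e.+1 + 2 + _ = f); last lia.
apply: splits_facD; first by apply: splits_rev_edge => //; lia.
by apply: splits_fac; lia.
Qed.

(** If no change of letter precedes the pair at [e], the window starts one earlier, at a doubled
    letter; this costs 1 in the bound. *)
Lemma rev_edge_gap e f : k.+2 < e -> e + 2 * k + 4 <= N ->
  rev_edge e -> rev_edge f -> e.+1 < f -> e + k <= f.+1.
Proof.
case: e => [|[|e]] // he hN r1 r2 hf.
have [h|hne] := eqVneq (s e.+1) (s e.+2); last first.
  by apply: leqW; apply: rev_edge_gap_start => //; lia.
have hne : s e != s e.+1.
  apply/eqP => h'; have /eqP[] // : s e.+1 != s e.+2.
  by apply: no_cube => //; lia.
rewrite addSn ltnS; apply: rev_edge_gap_start => //; try lia.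
by apply: loop_rev_edge => //; lia.
Qed.

Lemma loop_gap e f : k.+2 < e -> f + 2 * k + 4 <= N ->
  s e = s e.+1 -> s f = s f.+1 -> e < f -> e + k <= f.
Proof.
case: e => // e he hN h1 h2 hef.
have hne : s e != s e.+1.
  apply/eqP => h'; have /eqP[] // : s e.+1 != s e.+2.
  by apply: no_cube => //; lia.
have hf : f != e.+2.
  apply/eqP => h'; rewrite h' in h2; have /eqP[] // : s e.+2 != s e.+3.
  by apply: no_cube => //; lia.
by apply: rev_edge_gap_start => //; try (apply: loop_rev_edge => //); lia.
Qed.

Lemma three_one_way_edges : 4 * k + 20 <= N -> exists p, p.+3 < N /\
  forall t, t < 3 -> ~~ rev_edge (p + t).
Proof.
move=> hN.
(* [rev_edge_gap] needs positions above [k.+2] and is used at [m.-1], hence [k.+4]. *)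
have [e he|none] := @pickP 'I_3 (fun t => rev_edge (k.+4 + t)); last first.
  exists k.+4; split=> [|t ht]; first lia.
  by have := none (Ordinal ht) => /= ->.
have [e3 he' {he}] := (ltn_ord e, he); set m := k.+4 + e in he'.
have gap f : rev_edge f -> m.+1 < f -> m + k <= f.+1.
  by move=> hf hlt; apply: rev_edge_gap => //; lia.
case he1: (rev_edge m.+1); last first.
  exists m.+1; split=> [|t ht]; first lia.
  case: t ht => [|t] ht; first by rewrite addn0 he1.
  by apply/negP => /gap; lia.
exists m.+2; split=> [|t ht]; first lia.
(* With [m] and [m.+1] both reversible, a change of letter before [m] gives the sharper gap [k],
   which reaches past [m + 4] as [5 <= k]. *)
have hne : s m.-1 != s m.-1.+1.
  apply/eqP => h; suff : m.-1 + k <= m.+2 by lia.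
  by apply: rev_edge_gap => //; try (apply: loop_rev_edge => //); lia.
apply/negP => hf; suff : m.-1.+1 + k <= m.+2 + t by lia.
by apply: rev_edge_gap_start => //; try lia; rewrite prednK.
Qed.

(* After three irreversible steps only the steps of a 3-cycle, and loops, are
   left: [r] numbers the letters along that cycle. *)
Lemma cyclic_steps : 4 * k + 20 <= N -> exists r : 'I_3 -> nat,
  (forall x y, r x = r y %[mod 3] -> x = y) /\
  forall j, j.+1 < N ->
    s j.+1 = s j \/ r (s j.+1) = r (s j) + 1 %[mod 3].
Proof.
move=> /three_one_way_edges [p [hp hr]].
move: (hr 0 isT) (hr 1 isT) (hr 2 isT); rewrite addn0 addn1 addn2 /rev_edge.
set a := s p; set b := s p.+1; set c := s p.+2; set d := s p.+3 => nba ncb ndc.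
have ab : infix [:: a; b] u by apply: infix_edge; lia.
have bc : infix [:: b; c] u by apply: infix_edge; lia.
have cd : infix [:: c; d] u by apply: infix_edge; lia.
have hab : a != b by apply: contraNneq nba => h; move: ab; rewrite h.
have hbc : b != c by apply: contraNneq ncb => h; move: bc; rewrite h.
have hcd : d != c by apply: contraNneq ndc => h; move: cd; rewrite h.
(* If [a = c], then [bc] would be the reversal of [ab]; similarly for [d = b]. *)
have hac : a != c by apply: contraNneq nba => h; rewrite h.
have hdb : d != b by apply: contraNneq ncb => h; rewrite -h.
have hda : d = a by apply: (ord3_third hbc) => //.
rewrite hda in ndc cd.
have cases x : [\/ x = a, x = b | x = c].
  have [|xa] := eqVneq x a; first by constructor 1.
  have [|xb] := eqVneq x b; first by constructor 2.
  by constructor 3; apply: (ord3_third hab) => //; rewrite eq_sym.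
exists (fun x => if x == a then 0 else if x == b then 1 else 2); split.
  move=> x y; case: (cases x) => ->; case: (cases y) => ->;
  by rewrite ?eqxx ?[b == a]eq_sym ?[c == a]eq_sym ?[c == b]eq_sym
     ?(negbTE hab) ?(negbTE hac) ?(negbTE hbc).
move=> j /infix_edge; case: (cases (s j)) => ->; case: (cases (s j.+1)) => ->;
  rewrite ?(negbTE nba) ?(negbTE ncb) ?(negbTE ndc) //;
  rewrite ?eqxx ?[b == a]eq_sym ?[c == a]eq_sym ?[c == b]eq_sym
     ?(negbTE hab) ?(negbTE hac) ?(negbTE hbc); by [left|right].
Qed.

(** * Contradiction along the 3-cycle *)

Lemma size_lt_large : N < 6 * k + 60.
Proof.
rewrite ltnNge; apply/negP => hN; have [|r [rI step]] := cyclic_steps; first lia.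
have walk j n : j + n < N -> (forall t, t < n -> s (j + t) != s (j + t).+1) ->
    r (s (j + n)) = r (s j) + n %[mod 3].
  elim: n => [|n IH] hj hl; first by rewrite !addn0.
  have [|h|h] := step (j + n); first lia.
    by have := hl n (leqnn _); rewrite h eqxx.
  have IH' : r (s (j + n)) = r (s j) + n %[mod 3].
    by apply: IH => [|t ht]; [lia|apply: hl; lia].
  by rewrite addnS h -modnDml IH' modnDml addn1 addnS.
have [e he|none] := @pickP 'I_(k + 6)
    (fun t => s (2 * k + 10 + t) == s (2 * k + 10 + t).+1); last first.
  have {}none t : t < k + 6 -> s (2 * k + 10 + t) != s (2 * k + 10 + t).+1.
    by move=> ht; have := none (Ordinal ht) => /= ->.
  (* Now [l + k] is a multiple of 3, and [x w x] has length at most [k + 6]. *)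
  pose l := 3 - k %% 3.
  apply: (@avoid_xwx (2 * k + 10) l k) => //; try lia.
    by apply: splits_fac; lia.
  move=> t ht; apply: rI; rewrite (_ : _ + k + t = 2 * k + 10 + t + (l + k)); last lia.
  rewrite (walk _ (l + k)); [|lia|by move=> t' ht'; have := none (t + t'); rewrite addnA; apply; lia].
  by rewrite -[in LHS](addn0 (r _)); apply/eqP; rewrite eqn_modDl; lia.
have [e3 {}he] := (ltn_ord e, eqP he); set m := 2 * k + 10 + e in he.
have only f : m - 4 <= f -> f < m + k -> f != m -> s f != s f.+1.
  move=> h1 h2 h3; apply/eqP => hf; case: (ltngtP f m) h3 => // hlt _.
    suff : f + k <= m by lia.
    by apply: loop_gap => //; lia.
  suff : m + k <= f by lia.
  by apply: loop_gap => //; lia.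
(* One pause lies between the copies of [x], so the shift [l + n] must be 1 modulo 3; [2 * l <= 4]
   fits the range of [only]. *)
have [l [n [hl hn hln]]] : exists l n, [/\ 0 < l <= 2, k <= n <= k.+1 &
    (l + n) %% 3 = 1].
  have : k %% 3 < 3 by rewrite ltn_mod.
  case hk: (k %% 3) => [|[|[]]] // _.
  - by exists 1, k; split; lia.
  - by exists 2, k.+1; split; lia.
  - by exists 1, k.+1; split; lia.
apply: (@avoid_xwx (m - 2 * l) l n) => //; try lia.
  (* The doubled letter sits [l] letters into [w] and costs one piece, so [n - 1 <= k] pieces
     suffice. *)
  have [q hq] : exists q, n = l + (2 + q) by exists (n - l - 2); lia.
  apply: (@splits_leq _ _ (l + (1 + q))); first lia.
  rewrite hq.
  apply: splits_facD; first by apply: splits_fac; lia.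
  rewrite (_ : m - 2 * l + l + l = m); last lia.
  apply: splits_facD; last by apply: splits_fac; lia.
  by apply: splits_rev_edge; [lia|apply: loop_rev_edge; [lia|]].
move=> t ht; apply: rI; set i := m - 2 * l + t.
rewrite (_ : _ + n + t = m.+1 + (i + l + n - m.+1)); last lia.
rewrite (walk m.+1); [|lia|move=> t' ht'; apply: only; lia].
(* The walk is cut at the pause, where the phase does not advance. *)
rewrite -he -modnDml {1}(_ : m = i + (m - i)); last lia.
rewrite (walk i); [|lia|move=> t' ht'; apply: only; lia].
rewrite modnDml -addnA -[in LHS](addn0 (r _)); apply/eqP; rewrite eqn_modDl; lia.
Qed.
End Large.

Theorem theorem4p2 (k : nat) (hk : 1 <= k) : unavoidable 3 (phi k).
Proof.
pose N := 6 * k + 60.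
have occ (u : seq 'I_3) : avoids u (phi k) -> size u < N.
  move=> hu; case: (leqP k 4) => hk4; last exact: size_lt_large.
  rewrite ltnNge; apply/negP => hN; apply: hu; apply: occurs_small; lia.
(* Avoiding words all lie in the list of words shorter than [N]. *)
apply; apply: cardinality.sub_finite_set (cardinality.finite_seq
  (flatten (mkseq (fun n => map val (enum {: n.-tuple 'I_3})) N))).
move=> u /occ hu /=; apply/flatten_mapP; exists (size u).
  by rewrite mem_iota.
by apply/mapP; exists (in_tuple u); rewrite ?mem_enum.
Qed.
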